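(* Let $\mathsf{V}$ be one of the varieties $\mathsf{FL}_e$, $\mathsf{FL}_{ew}$, $\mathsf{FL}_{ec}$. Then (a) every member of $m\mathsf{V}$ is functional; and (b) for every set $T\cup\{\varphi\approx\psi\}$ of equations between one-variable $\mathcal{L}_s$-formulas, \[ T\vDash^\forall_{\overline{\mathsf{V}}}\varphi\approx\psi\quad\Longleftrightarrow\quad T^\ast\vDash_{m\mathsf{V}}\varphi^\ast\approx\psi^\ast. \]
   Context: $\mathcal{L}_s$ is the signature with binary $\lor,\land,\cdot,\to$ and constants $\mathrm{f},\mathrm{e}$. An $\mathrm{FL}_\mathrm{e}$-algebra is an $\mathcal{L}_s$-algebra whose $\{\land,\lor\}$-reduct is a lattice, with $\langle A,\cdot,\mathrm{e}\rangle$ a commutative monoid and $a\cdot b\le c\iff a\le b\to c$. $\mathsf{FL}_e$ is the variety of all $\mathrm{FL}_\mathrm{e}$-algebras; $\mathsf{FL}_{ew}$ its subvariety satisfying $\mathrm{f}\le x\le\mathrm{e}$; $\mathsf{FL}_{ec}$ its subvariety satisfying $x\le x\cdot x$. $\overline{\mathsf{V}}$ is the class of members of $\mathsf{V}$ whose lattice reduct is complete. An m-$\mathcal{L}_s$-lattice is $\langle\mathbf{A},\Box,\Diamond\rangle$ with $\mathbf{A}$ an $\mathcal{L}_s$-algebra with lattice reduct, and unary $\Box,\Diamond$ satisfying $\Box x\land x\approx\Box x$, $\Diamond x\lor x\approx \Diamond x$, $\Box(x\land y)\approx\Box x\land\Box y$, $\Diamond(x\lor y)\approx\Diamond x\lor\Diamond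 y$, $\Box\Diamond x\approx\Diamond x$, $\Diamond\Box x\approx\Box x$, and $\Box(\star(\Box x_1,\dots,\Box x_n))\approx\star(\Box x_1,\dots,\Box x_n)$ for each $n$-ary $\star\in\mathcal{L}_s$; $m\mathsf{V}$ is the class of those with $\mathbf{A}\in\mathsf{V}$. For a complete $\mathbf{A}$ and set $W$, the full functional algebra $\langle\mathbf{A}^W,\Box,\Diamond\rangle$ has pointwise operations and $\Box f(u)=\bigwedge_{v\in W}f(v)$, $\Diamond f(u)=\bigvee_{v\in W}f(v)$; a member of $m\mathsf{V}$ is functional if isomorphic to a subalgebra of such a full functional algebra. One-variable $\mathcal{L}_s$-formulas are built from atoms $P_i(x)$ ($i\in\mathbb{N}$) with $\mathcal{L}_s$-connectives and $\forall x,\exists x$; modal formulas from variables $p_i$ with $\mathcal{L}_s$-connectives and $\Box,\Diamond$; $(\cdot)^\ast$ maps $P_i(x)\mapsto p_i$, commutes with connectives, $\forall x\mapsto\Box$, $\exists x\mapsto\Diamond$, applied elementwise to sets of equations. For complete $\mathbf{A}$, an $\mathbf{A}$-structure is $\mathcal{S}=\langle S,\mathcal{I}\rangle$, $S\ne\emptyset$, $\mathcal{I}(P_i)\colon S\to A$, with values $\|P_i(x)\|_u=\mathcal{I}(P_i)(u)$, connectives computed in $\mathbf{A}$, $\|\forall x\varphi\|_u=\bigwedge_{v\in S}\|\varphi\|_v$, $\|\exists x\varphi\|_u=\bigvee_{v\in S}\|\varphi\|_v$; $\mathcal{S}\models\varphi\approx\psi$ iff values agree at all $u$. $T\vDash^\forall_{\overline{\mathsf{V}}}\varphi\approx\psi$: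 every $\mathbf{A}$-structure with $\mathbf{A}\in\overline{\mathsf{V}}$ validating $T$ validates $\varphi\approx\psi$. $\Sigma\vDash_{m\mathsf{V}}\alpha\approx\beta$: every homomorphism $f$ from the modal formula algebra into a member of $m\mathsf{V}$ equalizing all equations in $\Sigma$ satisfies $f(\alpha)=f(\beta)$. *)

(* Defs.v *)
From mathcomp Require Import all_boot.
From Stdlib Require Import ClassicalEpsilon.

Set Implicit Arguments.
Unset Strict Implicit.
Unset Printing Implicit Defensive.

Inductive binary_symbol := Join | Meet | Mul | Imp.
Inductive constant_symbol := ConstF | ConstE.

Record Ls_algebra := LsAlgebra {
  carrier :> Type;
  bin : binary_symbol -> carrier -> carrier -> carrier;
  con : constant_symbol -> carrier
}.

Definition join (A : Ls_algebra) : A -> A -> A := bin Join.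
Definition meet (A : Ls_algebra) : A -> A -> A := bin Meet.
Definition mul (A : Ls_algebra) : A -> A -> A := bin Mul.
Definition imp (A : Ls_algebra) : A -> A -> A := bin Imp.
Definition cf (A : Ls_algebra) : A := con A ConstF.
Definition ce (A : Ls_algebra) : A := con A ConstE.
Arguments join {A}.
Arguments meet {A}.
Arguments mul {A}.
Arguments imp {A}.

Definition le (A : Ls_algebra) (x y : A) : Prop := meet x y = x.

Definition lattice_reduct (A : Ls_algebra) : Prop :=
  [/\ commutative (@meet A) /\ commutative (@join A),
      associative (@meet A) /\ associative (@join A),
      forall x y : A, meet x (join x y) = x
    & forall x y : A, join x (meet x y) = x].

Definition FLe (A : Ls_algebra) : Prop :=
  [/\ lattice_reduct A,
      [/\ associative (@mul A), commutative (@mul A) & left_id (ce A) (@mul A)]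
    & forall x y z : A, le (mul x y) z <-> le x (imp y z)].

Definition FLew (A : Ls_algebra) : Prop :=
  FLe A /\ forall x : A, le (cf A) x /\ le x (ce A).

Definition FLec (A : Ls_algebra) : Prop :=
  FLe A /\ forall x : A, le x (mul x x).

Definition is_glb (A : Ls_algebra) (P : A -> Prop) (m : A) : Prop :=
  (forall x, P x -> le m x) /\ (forall y, (forall x, P x -> le y x) -> le y m).

Definition is_lub (A : Ls_algebra) (P : A -> Prop) (m : A) : Prop :=
  (forall x, P x -> le x m) /\ (forall y, (forall x, P x -> le x y) -> le m y).

Definition complete (A : Ls_algebra) : Prop :=
  forall P : A -> Prop, (exists m, is_glb P m) /\ (exists m, is_lub P m).

Definition complete_members (V : Ls_algebra -> Prop) (A : Ls_algebra) : Prop :=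
  V A /\ complete A.

(* [bigmeet] and [bigjoin] are total: their value is arbitrary if the family
   has no greatest lower (least upper) bound.  They are used below only for
   families in complete algebras. *)
Definition bigmeet (A : Ls_algebra) (I : Type) (g : I -> A) : A :=
  epsilon (inhabits (ce A)) (is_glb (fun x => exists i, g i = x)).

Definition bigjoin (A : Ls_algebra) (I : Type) (g : I -> A) : A :=
  epsilon (inhabits (ce A)) (is_lub (fun x => exists i, g i = x)).

Record modal_algebra := ModalAlgebra {
  base :> Ls_algebra;
  box : base -> base;
  dia : base -> base
}.
Arguments box {m}.
Arguments dia {m}.

Definition m_lattice (M : modal_algebra) : Prop :=
  [/\ lattice_reduct M,
      (forall x : M, meet (box x) x = box x) /\
        (forall x : M, join (dia x) x = dia x),
      (forall x y : M, box (meet x y) = meet (box x) (box y)) /\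
        (forall x y : M, dia (join x y) = join (dia x) (dia y)),
      (forall x : M, box (dia x) = dia x) /\
        (forall x : M, dia (box x) = box x)
    & (forall (s : binary_symbol) (x y : M),
          box (bin s (box x) (box y)) = bin s (box x) (box y)) /\
        (forall c : constant_symbol, box (con M c) = con M c)].

Definition mV (V : Ls_algebra -> Prop) (M : modal_algebra) : Prop :=
  m_lattice M /\ V M.

Definition is_hom (M N : modal_algebra) (h : M -> N) : Prop :=
  [/\ forall s (x y : M), h (bin s x y) = bin s (h x) (h y),
      forall c, h (con M c) = con N c,
      forall x : M, h (box x) = box (h x)
    & forall x : M, h (dia x) = dia (h x)].

Definition isomorphic (M N : modal_algebra) : Prop :=
  exists h : M -> N, is_hom h /\ bijective h.

Record subuniverse (M : modal_algebra) := Subuniverse {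
  mem :> M -> Prop;
  mem_bin : forall s x y, mem x -> mem y -> mem (bin s x y);
  mem_con : forall c, mem (con M c);
  mem_box : forall x, mem x -> mem (box x);
  mem_dia : forall x, mem x -> mem (dia x)
}.

Definition subalgebra (M : modal_algebra) (S : subuniverse M) : modal_algebra :=
  @ModalAlgebra
    (@LsAlgebra {x : M | S x}
       (fun s x y => exist _ _ (mem_bin s (proj2_sig x) (proj2_sig y)))
       (fun c => exist _ _ (mem_con S c)))
    (fun x => exist _ _ (mem_box (proj2_sig x)))
    (fun x => exist _ _ (mem_dia (proj2_sig x))).

Definition power (A : Ls_algebra) (W : Type) : Ls_algebra :=
  @LsAlgebra (W -> A) (fun s f g u => bin s (f u) (g u)) (fun c _ => con A c).

Definition full_functional (A : Ls_algebra) (W : Type) : modal_algebra :=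
  @ModalAlgebra (power A W) (fun f _ => bigmeet f) (fun f _ => bigjoin f).

(* Functionality is relative to V: the complete algebra A is itself in V, so
   that A^W is a full functional member of mV. *)
Definition functional (V : Ls_algebra -> Prop) (M : modal_algebra) : Prop :=
  exists (A : Ls_algebra) (W : Type) (S : subuniverse (full_functional A W)),
    complete_members V A /\ isomorphic M (subalgebra S).

Inductive fo_formula :=
  | Atom of nat
  | FBin of binary_symbol & fo_formula & fo_formula
  | FCon of constant_symbol
  | All of fo_formula
  | Ex of fo_formula.

Inductive modal_formula :=
  | Var of nat
  | MBin of binary_symbol & modal_formula & modal_formula
  | MCon of constant_symbol
  | Box of modal_formula
  | Dia of modal_formula.

Definition equation (F : Type) : Type := (F * F)%type.

Fixpoint star (phi : fo_formula) : modal_formula :=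
  match phi with
  | Atom i => Var i
  | FBin s phi1 phi2 => MBin s (star phi1) (star phi2)
  | FCon c => MCon c
  | All phi1 => Box (star phi1)
  | Ex phi1 => Dia (star phi1)
  end.

Definition star_eq (e : equation fo_formula) : equation modal_formula :=
  (star e.1, star e.2).

Definition star_set (T : equation fo_formula -> Prop) :
    equation modal_formula -> Prop :=
  fun e => exists e0, T e0 /\ star_eq e0 = e.

Record structure (A : Ls_algebra) := Structure {
  domain : Type;
  domain_nonempty : inhabited domain;
  interp : nat -> domain -> A
}.

Fixpoint value (A : Ls_algebra) (S : structure A) (phi : fo_formula)
    (u : domain S) : A :=
  match phi with
  | Atom i => interp i u
  | FBin s phi1 phi2 => bin s (value phi1 u) (value phi2 u)
  | FCon c => con A c
  | All phi1 => bigmeet (fun v : domain S => value phi1 v)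
  | Ex phi1 => bigjoin (fun v : domain S => value phi1 v)
  end.

Definition satisfies (A : Ls_algebra) (S : structure A)
    (e : equation fo_formula) : Prop :=
  forall u : domain S, value e.1 u = value e.2 u.

(* The consequence relation over V is obtained for
   [K := complete_members V]; [value] is meaningful only in complete algebras. *)
Definition fo_consequence (K : Ls_algebra -> Prop)
    (T : equation fo_formula -> Prop) (e : equation fo_formula) : Prop :=
  forall (A : Ls_algebra), K A -> forall S : structure A,
    (forall e0, T e0 -> satisfies S e0) -> satisfies S e.

Definition modal_formula_algebra : modal_algebra :=
  @ModalAlgebra (@LsAlgebra modal_formula MBin MCon) Box Dia.

Definition modal_consequence (K : modal_algebra -> Prop)
    (Sigma : equation modal_formula -> Prop) (e : equation modal_formula) :
    Prop :=
  forall M : modal_algebra, K M ->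
  forall h : modal_formula_algebra -> M, is_hom h ->
    (forall e0, Sigma e0 -> h e0.1 = h e0.2) -> h e.1 = h e.2.

(* Main.v *)
(* For [M] in [mV], amalgamate countably many copies of [M] over its subalgebra
   of [box]-fixed elements.  A tuple [x] of finite support stands for the product
   over [k] of [x_k] taken in the [k]-th copy.  Since [dia a] is the least fixed
   element above [a], it is the best interpolant: in the amalgam the product is
   below [a] of the [j]-th copy iff [eval j x] (the product of [x_j] and of all
   [dia x_k], [k <> j]) is below [a] in [M].  This relation is a residuated frame
   whose closed sets form a complete FLe-algebra, and [a] is sent to the family
   of sets [{x | eval i x <= a}], indexed by [i].  A copy fresh for the tuples
   involved turns the meet over [i] into [box a] and the join into [dia a]. *)
From HB Require Import structures.
From mathcomp Require Import all_boot.
From Stdlib Require Import ClassicalEpsilon FunctionalExtensionality.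
From Stdlib Require Import PropExtensionality ProofIrrelevance.
Require Import Defs.

Set Implicit Arguments.
Unset Strict Implicit.
Unset Printing Implicit Defensive.

(** * Lattice order, greatest lower and least upper bounds *)

Section LatticeOrder.
Variables (A : Ls_algebra) (latA : lattice_reduct A).
Implicit Types x y z : A.

Lemma meet_idem x : meet x x = x.
Proof. by case: latA => _ _ mj jm; rewrite -{2}[x](jm x x) mj. Qed.

Lemma le_refl x : le x x.
Proof. exact: meet_idem. Qed.

Lemma le_anti x y : le x y -> le y x -> x = y.
Proof. by case: latA => [[mC _] _ _ _]; rewrite /le => xy yx; rewrite -xy mC. Qed.

Lemma le_trans y x z : le x y -> le y z -> le x z.
Proof. by case: latA => [_ [mA _] _ _] xy yz; rewrite /le -xy -mA yz. Qed.

Lemma le_meetl x y : le (meet x y) x.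
Proof. by case: latA => [[mC _] [mA _] _ _]; rewrite /le mC mA meet_idem. Qed.

Lemma le_meetr x y : le (meet x y) y.
Proof. by case: latA => [[mC _] [mA _] _ _]; rewrite /le -mA meet_idem. Qed.

Lemma le_meet z x y : le z x -> le z y -> le z (meet x y).
Proof. by case: latA => [_ [mA _] _ _]; rewrite /le mA => -> ->. Qed.

Lemma le_join x y : le x y <-> join x y = y.
Proof.
case: latA => [[mC jC] _ mj jm]; split=> [xy|<-]; last exact: mj.
by rewrite -xy jC mC.
Qed.

Lemma le_joinl x y : le x (join x y).
Proof. by case: latA => _ _ mj _; apply: mj. Qed.

Lemma le_joinr x y : le y (join x y).
Proof. by case: latA => [[_ jC] _ mj _]; rewrite jC; apply: mj. Qed.

Lemma join_le x y z : le x z -> le y z -> le (join x y) z.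
Proof.
case: latA => [_ [_ jA] _ _] /le_join xz /le_join yz.
by apply/le_join; rewrite -jA yz.
Qed.

Lemma glb_unique (P : A -> Prop) a b : is_glb P a -> is_glb P b -> a = b.
Proof. by move=> [la ga] [lb gb]; apply: le_anti; [exact: gb _ la|exact: ga _ lb]. Qed.

Lemma lub_unique (P : A -> Prop) a b : is_lub P a -> is_lub P b -> a = b.
Proof. by move=> [ua la] [ub lb]; apply: le_anti; [exact: la _ ub|exact: lb _ ua]. Qed.

(** Once some bound [a] exists, [epsilon] picks a greatest lower bound, and uniqueness identifies it
    with [a]. Completeness of the whole algebra does not enter, only this one family. *)
Lemma bigmeet_glb (I : Type) (g : I -> A) a :
  is_glb (fun x => exists i, g i = x) a -> bigmeet g = a.
Proof. by move=> ga; apply: (glb_unique _ ga); apply: epsilon_spec; exists a. Qed.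

Lemma bigjoin_lub (I : Type) (g : I -> A) a :
  is_lub (fun x => exists i, g i = x) a -> bigjoin g = a.
Proof. by move=> ga; apply: (lub_unique _ ga); apply: epsilon_spec; exists a. Qed.

End LatticeOrder.

(** * Residuation and monotonicity of multiplication *)

Section FLeOrder.
Variables (A : Ls_algebra) (fleA : FLe A).
Implicit Types x y z : A.

Let latA : lattice_reduct A. Proof. by case: fleA. Qed.

Lemma mulA : associative (@mul A). Proof. by case: fleA => _ []. Qed.
Lemma mulC : commutative (@mul A). Proof. by case: fleA => _ []. Qed.
Lemma mul1x : left_id (ce A) (@mul A). Proof. by case: fleA => _ []. Qed.
Lemma mulx1 : right_id (ce A) (@mul A). Proof. by move=> x; rewrite mulC mul1x. Qed.

Lemma le_residuation x y z : le (mul x y) z <-> le x (imp y z).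
Proof. by case: fleA. Qed.

Lemma le_mul2r y x z : le x z -> le (mul x y) (mul z y).
Proof.
move=> xz; apply/le_residuation/(le_trans latA xz)/le_residuation.
exact: le_refl.
Qed.

Lemma le_mul x1 x2 y1 y2 : le x1 x2 -> le y1 y2 -> le (mul x1 y1) (mul x2 y2).
Proof.
move=> lx ly; apply: (le_trans latA (y := mul x2 y1)); first exact: le_mul2r.
by rewrite ![mul x2 _]mulC; apply: le_mul2r.
Qed.

Lemma imp_mul_le x y : le (mul (imp x y) x) y.
Proof. by apply/le_residuation/le_refl. Qed.

End FLeOrder.

(** * Powers, and full functional algebras as m-lattices *)

Section Power.
Variables (A : Ls_algebra) (W : Type).

Lemma le_power (f g : power A W) : le f g <-> forall u, le (f u) (g u).
Proof.
split=> [fg u|fg]; first exact: (congr1 (fun h => h u) fg).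
by apply: functional_extensionality => u; apply: fg.
Qed.

Lemma lattice_power : lattice_reduct A -> lattice_reduct (power A W).
Proof.
case=> [[mC jC] [mA jA] mj jm]; split=> //; last first.
- by move=> f g; apply: functional_extensionality => u; apply: jm.
- by move=> f g; apply: functional_extensionality => u; apply: mj.
- by split=> f g h; apply: functional_extensionality => u; [apply: mA|apply: jA].
by split=> f g; apply: functional_extensionality => u; [apply: mC|apply: jC].
Qed.

Lemma FLe_power : FLe A -> FLe (power A W).
Proof.
case=> [lat [mA mC m1] res]; split; first exact: lattice_power.
  split; first by move=> f g h; apply: functional_extensionality => u; apply: mA.
    by move=> f g; apply: functional_extensionality => u; apply: mC.
  by move=> f; apply: functional_extensionality => u; apply: m1.
by move=> f g h; rewrite !le_power; split=> H u; apply/res; apply: H.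
Qed.

Lemma FLew_power : FLew A -> FLew (power A W).
Proof.
case=> flA w; split; first exact: FLe_power.
by move=> f; split; apply/le_power => u; case: (w (f u)).
Qed.

Lemma FLec_power : FLec A -> FLec (power A W).
Proof.
case=> flA c; split; first exact: FLe_power.
by move=> f; apply/le_power => u; apply: c.
Qed.

Hypotheses (latA : lattice_reduct A) (cA : complete A) (W0 : inhabited W).

Lemma glb_bigmeet (I : Type) (g : I -> A) :
  is_glb (fun x => exists i, g i = x) (bigmeet g).
Proof. by apply: epsilon_spec; case: (cA (fun x => exists i, g i = x)). Qed.

Lemma lub_bigjoin (I : Type) (g : I -> A) :
  is_lub (fun x => exists i, g i = x) (bigjoin g).
Proof. by apply: epsilon_spec; case: (cA (fun x => exists i, g i = x)). Qed.

Lemma bigmeet_const (a : A) : bigmeet (fun _ : W => a) = a.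
Proof.
case: W0 => w; apply: bigmeet_glb => //; split=> [x [_ <-]|y]; first exact: le_refl.
by apply; exists w.
Qed.

Lemma bigjoin_const (a : A) : bigjoin (fun _ : W => a) = a.
Proof.
case: W0 => w; apply: bigjoin_lub => //; split=> [x [_ <-]|y]; first exact: le_refl.
by apply; exists w.
Qed.

(** [box f] and [dia f] are constant functions, and pointwise operations keep constants constant.
    Over an inhabited [W] the meet and the join of a constant family are that constant, which yields
    the axioms on boxed elements. *)
Lemma m_lattice_full_functional : m_lattice (full_functional A W).
Proof.
have mlb (g : W -> A) u : le (bigmeet g) (g u).
  by case: (glb_bigmeet g) => lb _; apply: lb; exists u.
have jub (g : W -> A) u : le (g u) (bigjoin g).
  by case: (lub_bigjoin g) => ub _; apply: ub; exists u.
split; first exact: lattice_power.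
- split=> f; apply: functional_extensionality => u; first exact: mlb.
  case: latA => [[_ jC] _ _ _]; rewrite /join /= -/(join _ _) jC.
  exact/le_join.
- split=> f g; apply: functional_extensionality => u.
    apply: bigmeet_glb => //; split=> [_ [v <-]|y yfg].
      apply: (le_meet latA).
        by apply: le_trans (mlb f v); rewrite //; apply: le_meetl.
      by apply: le_trans (mlb g v); rewrite //; apply: le_meetr.
    apply: (le_meet latA).
      case: (glb_bigmeet f) => _; apply=> _ [v <-].
      apply: (le_trans latA (yfg _ (ex_intro _ v erefl))).
      exact: le_meetl.
    case: (glb_bigmeet g) => _; apply=> _ [v <-].
    apply: (le_trans latA (yfg _ (ex_intro _ v erefl))).
    exact: le_meetr.
  apply: bigjoin_lub => //; split=> [_ [v <-]|y yfg].
    apply: (join_le latA).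
      by apply: (le_trans latA) (jub f v) _; apply: le_joinl.
    by apply: (le_trans latA) (jub g v) _; apply: le_joinr.
  apply: (join_le latA).
    case: (lub_bigjoin f) => _; apply=> _ [v <-].
    apply: (le_trans latA) (yfg _ (ex_intro _ v erefl)).
    exact: le_joinl.
  case: (lub_bigjoin g) => _; apply=> _ [v <-].
  apply: (le_trans latA) (yfg _ (ex_intro _ v erefl)).
  exact: le_joinr.
- by split=> f; apply: functional_extensionality => u;
    [apply: (bigmeet_const (bigjoin f))|apply: (bigjoin_const (bigmeet f))].
split=> [s f g|c]; apply: functional_extensionality => u.
  exact: (bigmeet_const (bin s (bigmeet f) (bigmeet g))).
exact: (bigmeet_const (con A c)).
Qed.

End Power.

(** * The algebra of Galois-closed sets of a residuated frame *)

Section ClosedSets.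
Variables (X Y : Type) (op : X -> X -> X) (u : X) (N : X -> Y -> Prop).
Hypotheses (opA : associative op) (opC : commutative op) (op1 : left_id u op).
Implicit Types P Q R : X -> Prop.

(** The Galois closure of the frame whose tests are pairs [(z, w)]: translate by [z], then compare
    with [w]. Building the translation into the test makes [cl] a nucleus for an arbitrary relation
    [N]. *)
Definition cl P x :=
  forall z w, (forall y, P y -> N (op y z) w) -> N (op x z) w.

Definition closed P := forall x, cl P x -> P x.

Lemma cl_ext P x : P x -> cl P x.
Proof. by move=> Px z w; apply. Qed.

Lemma closed_cl P : closed (cl P).
Proof. by move=> x clx z w PN; apply: clx => y; apply. Qed.

Lemma cl_sub P Q : closed Q -> (forall x, P x -> Q x) -> forall x, cl P x -> Q x.
Proof. by move=> cQ PQ x Px; apply: cQ => z w QN; apply: Px => y /PQ /QN. Qed.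

Definition setI P Q x := P x /\ Q x.
Definition setU P Q x := P x \/ Q x.
Definition setM P Q x := exists y z, [/\ P y, Q z & x = op y z].
Definition setR P Q x := forall y, P y -> Q (op x y).

Lemma closed_setI P Q : closed P -> closed Q -> closed (setI P Q).
Proof. by move=> cP cQ x c; split; apply: cl_sub c => // y []. Qed.

(** A test [(z, w)] of [Q] at [op x y] is the test [(op y z, w)] at [x]; this is where the
    translations in [cl] are used. *)
Lemma closed_setR P Q : closed Q -> closed (setR P Q).
Proof.
move=> cQ x clx y Py; apply: cQ => z w QN; rewrite -opA.
by apply: clx => x' x'PQ; rewrite opA; apply/QN/x'PQ.
Qed.

Lemma cl_setM_sub P Q R : closed R ->
  (forall x y, P x -> Q y -> R (op x y)) -> forall x, cl (setM P Q) x -> R x.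
Proof. by move=> cR H; apply: cl_sub => // _ [y [z [Py Qz ->]]]; apply: H. Qed.

Lemma cl_setM P Q x y : P x -> Q y -> cl (setM P Q) (op x y).
Proof. by move=> Px Qy; apply: cl_ext; exists x, y. Qed.

Definition closed_set := {P : X -> Prop | closed P}.

Lemma closed_set_eq (P Q : closed_set) :
  (forall x, proj1_sig P x <-> proj1_sig Q x) -> P = Q.
Proof.
case: P Q => [P cP] [Q cQ] /= PQ.
have E : P = Q.
  by apply: functional_extensionality => x; apply: propositional_extensionality.
by move: cQ; rewrite -E => cQ; rewrite (proof_irrelevance _ cP cQ).
Qed.

Definition clset P : closed_set := exist _ (cl P) (@closed_cl P).

Variable F : closed_set.

Definition closed_bin (s : binary_symbol) (P Q : closed_set) : closed_set :=
  match s with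
  | Join => clset (setU (proj1_sig P) (proj1_sig Q))
  | Meet => exist _ _ (closed_setI (proj2_sig P) (proj2_sig Q))
  | Mul => clset (setM (proj1_sig P) (proj1_sig Q))
  | Imp => exist _ _ (@closed_setR (proj1_sig P) _ (proj2_sig Q))
  end.

Definition closed_con (c : constant_symbol) : closed_set :=
  match c with ConstF => F | ConstE => clset (fun x => x = u) end.

Definition closed_algebra : Ls_algebra := LsAlgebra closed_bin closed_con.

Implicit Types C D : closed_algebra.

Lemma le_closed C D :
  le C D <-> forall x, proj1_sig C x -> proj1_sig D x.
Proof.
split=> [CD x Cx|CD].
  by move: Cx; rewrite -{1}CD => -[].
by apply: closed_set_eq => x; split=> [[]//|Cx]; split=> //; apply: CD.
Qed.

Lemma closed_lattice : lattice_reduct closed_algebra.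
Proof.
have JC (C D : closed_algebra) x : proj1_sig (join C D) x -> proj1_sig (join D C) x.
  apply: cl_sub; first exact: closed_cl.
  by move=> y [?|?]; apply: cl_ext; [right|left].
split.
- by split=> C D; apply: closed_set_eq => x; split; try exact: JC; case.
- split=> B C D; apply: closed_set_eq => x.
    by split=> [[? []]|[[]]].
  split; apply: cl_sub; try exact: closed_cl.
    move=> y [By|]; first by apply: cl_ext; left; apply: cl_ext; left.
    apply: cl_sub y; first exact: closed_cl.
    by move=> y [Cy|Dy]; apply: cl_ext; [left; apply: cl_ext; right|right].
  move=> y [|Dy]; last by apply: cl_ext; right; apply: cl_ext; right.
  apply: cl_sub y; first exact: closed_cl.
  by move=> y [By|Cy]; apply: cl_ext; [left|right; apply: cl_ext; left].
- move=> C D; apply: closed_set_eq => x; split=> [[]//|Cx].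
  by split=> //; apply: cl_ext; left.
move=> C D; apply: closed_set_eq => x; split=> [|Cx]; last by apply: cl_ext; left.
by apply: cl_sub => [|y [|[]]//]; apply: proj2_sig.
Qed.

(** A closure nested inside a product is removed by residuation: to multiply an element of [cl P] by
    [b] and land in a closed [R], it suffices to place [P] inside a residual [setR] of [R], which is
    closed. Commutativity turns one inclusion of associativity into the other. *)
Lemma closed_FLe : FLe closed_algebra.
Proof.
have clP C : closed (proj1_sig C) by apply: proj2_sig.
have MC (C D : closed_algebra) x : proj1_sig (mul C D) x -> proj1_sig (mul D C) x.
  apply: cl_setM_sub; first exact: closed_cl.
  by move=> y z Cy Dz; rewrite opC; apply: cl_setM.
have mC : commutative (@mul closed_algebra).
  by move=> C D; apply: closed_set_eq => x; split; apply: MC.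
split; first exact: closed_lattice.
  have MA (B C D : closed_algebra) x :
      proj1_sig (mul B (mul C D)) x -> proj1_sig (mul (mul B C) D) x.
    apply: cl_setM_sub; first exact: closed_cl.
    move=> b y Bb; rewrite opC.
    have cR : closed (setR (proj1_sig B) (proj1_sig (mul (mul B C) D))).
      exact: (closed_setR (clP (mul (mul B C) D))).
    move=> CDy; apply: (cl_setM_sub cR) CDy _ Bb => c d Cc Dd b' Bb'.
    rewrite opC opA; apply: cl_setM => //; exact: cl_setM.
  split=> //.
    move=> B C D; apply: closed_set_eq => x; split; first exact: MA.
    by rewrite [mul B C]mC mC [mul B _]mC [mul C D]mC => /MA.
  move=> C; apply: closed_set_eq => x; split.
    apply: cl_setM_sub => // y z uy Cz; rewrite opC.
    have cR : closed (setR (proj1_sig C) (proj1_sig C)) by apply: closed_setR (clP C).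
    rewrite opC; apply: (cl_sub cR) uy z Cz => _ -> z Cz.
    by rewrite op1.
  by rewrite -{2}[x]op1 => Cx; apply: cl_setM => //; apply: cl_ext.
move=> B C D; rewrite !le_closed; split=> H x.
  by move=> Bx y Cy; apply: H; apply: cl_setM.
by apply: cl_setM_sub => // b c Bb; apply: H.
Qed.

Lemma closed_complete : complete closed_algebra.
Proof.
move=> P; split.
  have cI : closed (fun x => forall C : closed_algebra, P C -> proj1_sig C x).
    by move=> x clx C PC; apply: (cl_sub (proj2_sig C)) clx => y; apply.
  exists (exist _ _ cI : closed_algebra); split=> [C PC|D DP].
    by apply/le_closed => x /=; apply.
  by apply/le_closed => x Dx C PC; move/le_closed: (DP C PC); apply.
exists (clset (fun x => exists C : closed_algebra, P C /\ proj1_sig C x)).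
split=> [C PC|D PD].
  by apply/le_closed => x Cx; apply: cl_ext; exists C.
apply/le_closed; apply: cl_sub; first exact: proj2_sig.
by move=> x [C [PC Cx]]; move/le_closed: (PD C PC); apply.
Qed.

End ClosedSets.

(** * Fixed elements, tuples over the copies of [M], and their evaluations *)

Section Representation.
Variables (M : modal_algebra) (mM : m_lattice M) (fleM : FLe M).

Let latM : lattice_reduct M. Proof. by case: fleM. Qed.
Let mulAM := mulA fleM.
Let mulCM := mulC fleM.
Let mul1M := mul1x fleM.
Let trans := le_trans latM.

HB.instance Definition _ :=
  Monoid.isComLaw.Build (carrier M) (ce M) (@mul M) mulAM mulCM mul1M.

Implicit Types a b c d : M.

Notation "\mulall_ ( i < n | P ) F" := (\big[@mul M/ce M]_(i < n | P%B) F)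
  (at level 36, i, n at level 50, F at level 36).
Notation "\mulall_ ( i < n ) F" := (\big[@mul M/ce M]_(i < n) F)
  (at level 36, i, n at level 50, F at level 36).

(** These are exactly the values of [dia], and also those of [box]. They form the subalgebra over
    which the copies are amalgamated. *)
Definition fixed (c : M) := dia c = c.

Lemma box_fixed c : fixed c -> box c = c.
Proof. by case: mM => _ _ _ [bd _] _ fc; rewrite -fc bd. Qed.

Lemma fixed_box a : fixed (box a).
Proof. by case: mM => _ _ _ [_ db] _; apply: db. Qed.

Lemma fixed_dia a : fixed (dia a).
Proof. by case: mM => _ _ _ [bd _] _; rewrite -bd; apply: fixed_box. Qed.

Lemma fixed_bin s c d : fixed c -> fixed d -> fixed (bin s c d).
Proof.
case: mM => _ _ _ _ [bb _] /box_fixed <- /box_fixed <-.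
by rewrite -bb; apply: fixed_box.
Qed.

Lemma fixed_con (c : constant_symbol) : fixed (con M c).
Proof. by case: mM => _ _ _ _ [_ bc]; rewrite -bc; apply: fixed_box. Qed.

Lemma box_le a : le (box a) a.
Proof. by case: mM => _ [bl _] _ _ _; apply: bl. Qed.

Lemma le_dia a : le a (dia a).
Proof.
case: mM => _ [_ dj] _ _ _; apply/le_join => //.
by case: latM => [[_ jC] _ _ _]; rewrite jC dj.
Qed.

Lemma dia_mono a b : le a b -> le (dia a) (dia b).
Proof.
case: mM => _ _ [_ dj] _ _ /(le_join latM) ab.
by apply/le_join => //; rewrite -dj ab.
Qed.

Lemma box_mono a b : le a b -> le (box a) (box b).
Proof. by case: mM => _ _ [bm _] _ _; rewrite /le => ab; rewrite -bm ab. Qed.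

Lemma dia_le a c : fixed c -> le a c -> le (dia a) c.
Proof. by move=> fc /dia_mono; rewrite fc. Qed.

Lemma le_box c a : fixed c -> le c a -> le c (box a).
Proof. by move=> fc /box_mono; rewrite box_fixed. Qed.

Lemma fixed_prod n (P : pred 'I_n) (F : 'I_n -> M) :
  (forall i, P i -> fixed (F i)) -> fixed (\mulall_(i < n | P i) F i).
Proof.
move=> fF; apply: (big_ind fixed) => // [|c d].
  exact: fixed_con.
exact: fixed_bin.
Qed.

Lemma le_prod n (P : pred 'I_n) (F G : 'I_n -> M) :
  (forall i, P i -> le (F i) (G i)) ->
  le (\mulall_(i < n | P i) F i) (\mulall_(i < n | P i) G i).
Proof.
move=> FG; apply: (big_ind2 (@le M)) => // [|a b c d].
  exact: le_refl.
exact: le_mul.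
Qed.

(** An entry [a] of copy [k] as seen from copy [j]: exact in its own copy, elsewhere replaced by the
    least fixed element above it. *)
Definition dia_off (j k : nat) (a : M) := if k == j then a else dia a.

Lemma dia_off_mono j k a b : le a b -> le (dia_off j k a) (dia_off j k b).
Proof. by rewrite /dia_off; case: ifP => // _; apply: dia_mono. Qed.

Lemma dia_off_join j k a b :
  dia_off j k (join a b) = join (dia_off j k a) (dia_off j k b).
Proof. by rewrite /dia_off; case: ifP => // _; case: mM => _ _ [_ dj] _ _. Qed.

Lemma dia_off_fixed j k c : fixed c -> dia_off j k c = c.
Proof. by rewrite /dia_off; case: ifP. Qed.

Lemma dia_off_le_dia j k a : le (dia_off j k a) (dia a).
Proof. by rewrite /dia_off; case: ifP => _; [apply: le_dia|apply: le_refl]. Qed.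

(** [dia] is submultiplicative, since [mul (dia a) (dia b)] is fixed and lies above [mul a b]. In
    general this is only an inequality. *)
Lemma dia_off_mul j k a b :
  le (dia_off j k (mul a b)) (mul (dia_off j k a) (dia_off j k b)).
Proof.
rewrite /dia_off; case: ifP => _; first exact: le_refl.
apply: dia_le; first exact: fixed_bin (fixed_dia a) (fixed_dia b).
by apply: le_mul => //; apply: le_dia.
Qed.

(** Off the diagonal, [a] lies below the residual of [dia (mul c a)] by [c]. A residual of fixed
    elements is fixed, so [dia a] lies below it too. *)
Lemma mul_dia_off j k c a : fixed c ->
  le (mul c (dia_off j k a)) (dia_off j k (mul c a)).
Proof.
move=> fc; rewrite /dia_off; case: ifP => _; first exact: le_refl.
rewrite mulCM; apply/le_residuation => //; apply: dia_le.
  exact: fixed_bin fc (fixed_dia _).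
apply/le_residuation => //; rewrite mulCM; exact: le_dia.
Qed.

(** Lists read with default [ce M], hence of finite support. Lists that differ only in trailing
    units stay distinct; since [tmul] takes the maximum of the sizes, the monoid laws still hold as
    equalities of lists. *)
Definition tuples := seq M.
Notation coord := (nth (ce M)).
Definition tmul (x y : tuples) : tuples :=
  mkseq (fun k => mul (coord x k) (coord y k)) (maxn (size x) (size y)).
Definition tsingle (i : nat) (a : M) : tuples := set_nth (ce M) [::] i a.

Lemma coord_tmul x y k : coord (tmul x y) k = mul (coord x k) (coord y k).
Proof.
have [lt|ge] := ltnP k (maxn (size x) (size y)); first by rewrite nth_mkseq.
rewrite nth_default ?size_mkseq //.
by move: ge; rewrite geq_max => /andP[gx gy]; rewrite !nth_default ?mul1M.
Qed.

Lemma coord_tsingle i a k : coord (tsingle i a) k = if k == i then a else ce M.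
Proof. by rewrite nth_set_nth /= nth_nil. Qed.

Lemma tuples_eq (x y : tuples) : size x = size y -> coord x =1 coord y -> x = y.
Proof. by move=> s e; apply: (eq_from_nth (x0 := ce M)) => // i _; apply: e. Qed.

Lemma tmulA : associative tmul.
Proof.
move=> x y z; apply: tuples_eq => [|k]; first by rewrite !size_mkseq maxnA.
by rewrite !coord_tmul mulAM.
Qed.

Lemma tmulC : commutative tmul.
Proof.
move=> x y; apply: tuples_eq => [|k]; first by rewrite !size_mkseq maxnC.
by rewrite !coord_tmul mulCM.
Qed.

Lemma tmul1 : left_id [::] tmul.
Proof.
move=> x; apply: tuples_eq => [|k]; first by rewrite size_mkseq max0n.
by rewrite coord_tmul nth_nil mul1M.
Qed.

Definition eval (j : nat) (x : tuples) : M :=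
  \mulall_(k < size x) dia_off j k (coord x k).

(** The added factors come from the default [ce M], which is fixed, so they equal [ce M].
    Evaluations of tuples of different sizes can thus be compared over one range. *)
Lemma eval_widen n j x : size x <= n ->
  eval j x = \mulall_(k < n) dia_off j k (coord x k).
Proof.
move=> xn; rewrite /eval (big_ord_widen n (fun k => dia_off j k (coord x k)) xn).
rewrite big_mkcond; apply: eq_bigr => k _; case: ltnP => // xk.
by rewrite nth_default // dia_off_fixed //; apply: fixed_con.
Qed.

Lemma eval_tsingle j i a : eval j (tsingle i a) = dia_off j i a.
Proof.
rewrite (@eval_widen i.+1) ?size_set_nth ?maxn0 //.
rewrite (bigD1 ord_max) //= coord_tsingle eqxx big1 ?mulx1 // => k.
rewrite -val_eqE /= => /negbTE ki; rewrite coord_tsingle ki.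
by rewrite dia_off_fixed //; apply: fixed_con.
Qed.

Lemma eval_nil j : eval j [::] = ce M.
Proof. by rewrite /eval big_ord0. Qed.

Lemma eval_mul j x y : le (eval j (tmul x y)) (mul (eval j x) (eval j y)).
Proof.
set n := maxn (size x) (size y).
rewrite !(@eval_widen n) ?leq_maxl ?leq_maxr ?size_mkseq // -big_split /=.
by apply: le_prod => k _; rewrite coord_tmul; apply: dia_off_mul.
Qed.

(** [r] collects the factors outside [i] and does not depend on [a], so evaluations for different
    [a] can be compared. *)
Lemma eval_single_mul_factor j i z : exists r,
  eval j z = mul (dia_off j i (coord z i)) r /\
  forall a, eval j (tmul (tsingle i a) z) = mul (dia_off j i (mul a (coord z i))) r.
Proof.
(* The bound [i.+1] keeps position [i] in range even when it lies beyond the end of [z]. *)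
set n := maxn i.+1 (size z).
have lin : i < n by rewrite leq_maxl.
exists (\mulall_(k < n | k != Ordinal lin) dia_off j k (coord z k)); split=> [|a].
  by rewrite (@eval_widen n) ?leq_maxr // (bigD1 (Ordinal lin)).
rewrite (@eval_widen n) ?size_mkseq ?size_set_nth ?maxn0 //.
rewrite (bigD1 (Ordinal lin)) //= coord_tmul coord_tsingle eqxx; congr mul.
apply: eq_bigr => k; rewrite -val_eqE /= => /negbTE ki.
by rewrite coord_tmul coord_tsingle ki mul1M.
Qed.

Lemma eval_single_mul i z a : eval i (tmul (tsingle i a) z) = mul a (eval i z).
Proof.
have [r [-> ->]] := eval_single_mul_factor i i z.
by rewrite /dia_off eqxx mulAM.
Qed.

Lemma eval_single_fresh j i z a : i != j -> size z <= i ->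
  eval j (tmul (tsingle i a) z) = mul (dia a) (eval j z).
Proof.
move=> /negbTE ij zi; have [r [-> ->]] := eval_single_mul_factor j i z.
rewrite nth_default // (mulx1 fleM) /dia_off ij (fixed_con ConstE).
by rewrite mul1M.
Qed.

(** After the common factor [r] is residuated away, it remains that multiplication distributes over
    joins and that [dia_off] preserves them. *)
Lemma eval_single_join j i z a b c :
  le (eval j (tmul (tsingle i a) z)) c -> le (eval j (tmul (tsingle i b) z)) c ->
  le (eval j (tmul (tsingle i (join a b)) z)) c.
Proof.
have [r [_ E]] := eval_single_mul_factor j i z; rewrite !E.
move=> /(le_residuation fleM) ac /(le_residuation fleM) bc.
apply/(le_residuation fleM).
set w := coord z i in ac bc *.
apply: (@trans (dia_off j i (join (mul a w) (mul b w)))).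
  apply: dia_off_mono; apply/(le_residuation fleM).
  by apply: (join_le latM); apply/(le_residuation fleM);
    [apply: le_joinl|apply: le_joinr].
by rewrite dia_off_join; apply: join_le.
Qed.

(* Interpolation: the factors of [eval i x] outside [i] are fixed by [dia], so
   they can be moved past [dia_off j i]. *)
Lemma eval_subst i x a j z : le (eval i x) a ->
  le (eval j (tmul x z)) (eval j (tmul (tsingle i a) z)).
Proof.
set n := maxn i.+1 (maxn (size x) (size z)).
have lin : i < n by rewrite leq_maxl.
have [sx sz] : size x <= n /\ size z <= n by rewrite !leq_max !leqnn !orbT.
rewrite !(@eval_widen n) ?size_mkseq ?size_set_nth ?geq_max ?maxn0 ?lin ?sx ?sz //.
rewrite !(bigD1 (Ordinal lin) (P := predT)) //= !coord_tmul coord_tsingle eqxx.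
set c := (X in mul _ X) => cxa.
have fc : fixed c.
  apply: fixed_prod => k; rewrite -val_eqE /= => /negbTE ki.
  by rewrite /dia_off ki; apply: fixed_dia.
(* Here [c] is the part of [eval i x] outside [i]. Each factor of [tmul x z] at [k != i] splits into
   an [x]-part and a [z]-part; the [x]-part is at most [dia (coord x k)], and these bounds multiply
   to [c]. *)
apply: (@trans (mul (dia_off j i (mul (coord x i) (coord z i)))
   (mul c (\mulall_(k < n | k != Ordinal lin) dia_off j k (coord z k))))).
  apply: le_mul => //; first exact: le_refl.
  rewrite -big_split /=; apply: le_prod => k ki.
  rewrite coord_tmul; apply: trans (dia_off_mul _ _ _ _) _.
  apply: le_mul2r => //; rewrite {2}/dia_off -[(k : nat) == i]/(k == Ordinal lin).
  by rewrite (negbTE ki); apply: dia_off_le_dia.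
rewrite mulAM; apply: le_mul => //; last first.
  apply: le_prod => k; rewrite -val_eqE /= => /negbTE ki.
  by rewrite coord_tmul coord_tsingle ki mul1M; apply: le_refl.
rewrite mulCM; apply: trans (mul_dia_off _ _ _ fc) _; apply: dia_off_mono.
rewrite mulAM; apply: le_mul2r => //.
by move: cxa; rewrite {1}/dia_off eqxx mulCM.
Qed.

(** * The frame of the amalgam, its completion, and the embedding *)

Definition frame (x : tuples) (w : nat * M) : Prop := le (eval w.1 x) w.2.

Definition below (i : nat) (a : M) (x : tuples) : Prop := le (eval i x) a.

Lemma closed_below i a : closed tmul frame (below i a).
Proof.
move=> x clx; move: (clx [::] (i, a)); rewrite /frame /= tmulC tmul1; apply.
by move=> y; rewrite tmulC tmul1.
Qed.

Lemma below_single i a : below i a (tsingle i a).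
Proof. by rewrite /below eval_tsingle /dia_off eqxx; apply: le_refl. Qed.

(* [below i a] is the closed set generated by [tsingle i a]. *)
Lemma below_sub i a (P : tuples -> Prop) x : closed tmul frame P ->
  P (tsingle i a) -> below i a x -> P x.
Proof.
move=> cP Pa xa; apply: cP => z [j b] /(_ _ Pa); rewrite /frame /=.
by apply: trans; apply: eval_subst.
Qed.

(** The copies agree on fixed elements: the generator [tsingle i c] evaluates to [c] in every
    copy. *)
Lemma below_fixed i j c x : fixed c -> below i c x -> below j c x.
Proof.
move=> fc; apply: below_sub; first exact: closed_below.
by rewrite /below eval_tsingle dia_off_fixed //; apply: le_refl.
Qed.

Definition embed_set (i : nat) (a : M) : closed_set tmul frame :=
  exist _ _ (@closed_below i a).

(** Copy 0 is an arbitrary choice: [cf M] is fixed, so every copy gives the same closed set. *)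
Definition completion : Ls_algebra :=
  closed_algebra [::] tmulA (embed_set 0 (cf M)).

Definition embed (a : M) : full_functional completion nat :=
  fun i => embed_set i a.

Lemma completion_FLe : FLe completion.
Proof. exact: closed_FLe tmulC tmul1 _. Qed.

Lemma completion_complete : complete completion.
Proof. exact: closed_complete. Qed.

(** If [x] is below [cf M] in copy 0, it is so in every copy, and so is [tmul x z] because
    [eval j z] is at most [ce M]; hence [x] passes every test. For the upper bound, multiplying by
    [x] only decreases evaluations. *)
Lemma completion_FLew : FLew M -> FLew completion.
Proof.
case=> _ w; split; first exact: completion_FLe.
have eval1 j x : le (eval j x) (ce M) by case: (w (eval j x)).
move=> C; split; apply/le_closed => x.
  move=> xf; apply: (proj2_sig C) => z [j b] _; rewrite /frame /=.
  apply: trans (eval_mul j x z) _; apply: (@trans (cf M)); last by case: (w b).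
  rewrite -[cf M](mulx1 fleM); apply: le_mul => //.
  by apply: below_fixed xf; apply: fixed_con.
move=> _ z [j b] /(_ _ erefl); rewrite tmul1; apply: trans.
apply: trans (eval_mul j x z) _; rewrite -{2}[eval j z]mul1M.
exact: le_mul2r.
Qed.

(** Contraction in [M], applied entrywise, puts [eval j (tmul x z)] below the evaluation of
    [tmul (tmul x x) z], and [tmul x x] belongs to the product. *)
Lemma completion_FLec : FLec M -> FLec completion.
Proof.
case=> _ c; split; first exact: completion_FLe.
move=> C; apply/le_closed => x Cx z [j b] H.
apply: trans (H (tmul x x) _); last by exists x, x.
rewrite /= !(@eval_widen (maxn (size x) (size z))) ?size_mkseq ?maxnn //.
by apply: le_prod => k _; rewrite !coord_tmul; apply/dia_off_mono/le_mul2r.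
Qed.

(** For join and product, one inclusion is checked on the generator [tsingle i (bin s a b)] and the
    other follows since [below] is closed. For the residual, a member is applied to [tsingle i a],
    whose factor in copy [i] is exactly [a]. *)
Lemma embed_bin s (a b : M) : embed (bin s a b) = bin s (embed a) (embed b).
Proof.
apply: functional_extensionality => i; apply: closed_set_eq => x.
case: s.
- split.
    apply: below_sub; first exact: closed_cl.
    move=> z [j d] H; rewrite /frame /=.
    by apply: eval_single_join; apply: (H); [left|right]; apply: below_single.
  apply: cl_sub; first exact: closed_below.
  move=> y [ya|yb]; [apply: trans ya _|apply: trans yb _].
    exact: le_joinl.
  exact: le_joinr.
- split=> [xab|[xa xb]]; last exact: le_meet.
  by split; apply: trans xab _; [apply: le_meetl|apply: le_meetr].
- split.
    apply: below_sub; first exact: closed_cl.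
    have -> : tsingle i (bin Mul a b) = tmul (tsingle i a) (tsingle i b).
      apply: tuples_eq => [|k]; first by rewrite size_mkseq !size_set_nth maxnn.
      rewrite coord_tmul !coord_tsingle; case: ifP => // _; by rewrite mul1M.
    by apply: cl_setM; apply: below_single.
  apply: cl_setM_sub => [|y z ya zb]; first exact: closed_below.
  by apply: trans (eval_mul _ _ _) _; apply: le_mul.
split=> [xab y ya|H].
  apply: trans (eval_mul _ _ _) _; apply: trans (imp_mul_le fleM a b).
  exact: le_mul.
apply/(le_residuation fleM); rewrite mulCM -eval_single_mul tmulC.
exact/H/below_single.
Qed.

Lemma embed_con (c : constant_symbol) : embed (con M c) = con (full_functional completion nat) c.
Proof.
apply: functional_extensionality => i; apply: closed_set_eq => x; case: c.
  by split; apply: below_fixed; apply: fixed_con.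
split=> [xe z [j b] /(_ _ erefl)|].
  rewrite tmul1 /frame /=; apply: trans; apply: trans (eval_mul _ _ _) _.
  rewrite -{2}[eval j z]mul1M; apply: le_mul2r => //.
  by apply: below_fixed xe; apply: fixed_con.
apply: cl_sub; first exact: closed_below.
by move=> _ ->; rewrite /= /below eval_nil; apply: le_refl.
Qed.

Lemma embed_box a : embed (box a) = box (embed a).
Proof.
apply: functional_extensionality => i; symmetry; apply: bigmeet_glb.
  exact: closed_lattice.
split=> [_ [j <-]|C HC]; apply/le_closed => x.
  move=> xa; apply: (@trans (box a)); last exact: box_le.
  by apply: below_fixed xa; apply: fixed_box.
(* Copy [size x] is fresh for [x]: seen from it, every entry of [x] is under [dia], so the
   evaluation is fixed and being below [a] forces being below [box a]. *)
move=> Cx; apply: (@below_fixed (size x)); first exact: fixed_box.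
apply: le_box.
  by apply: fixed_prod => k _; rewrite /dia_off ltn_eqF //; apply: fixed_dia.
by move/le_closed: (HC _ (ex_intro _ (size x) erefl)); apply.
Qed.

Lemma embed_dia a : embed (dia a) = dia (embed a).
Proof.
apply: functional_extensionality => i; symmetry; apply: bigjoin_lub.
  exact: closed_lattice.
split=> [_ [j <-]|C HC]; apply/le_closed => x.
  move=> xa; apply: (@below_fixed j); first exact: fixed_dia.
  by apply: trans xa _; apply: le_dia.
apply: below_sub; first exact: proj2_sig.
apply: (proj2_sig C) => z [j b] Cz.
(* [m] is fresh for the test: it differs from [j] and [z] has no entry there. Hence [tsingle m a],
   which lies in [C], contributes exactly [dia a] when seen from copy [j]. *)
pose m := maxn j.+1 (size z).
have mj : m != j by rewrite gtn_eqF // leq_maxl.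
have zm : size z <= m by rewrite leq_maxr.
have : frame (tmul (tsingle m a) z) (j, b).
  apply: Cz; move/le_closed: (HC _ (ex_intro _ m erefl)); apply.
  exact: below_single.
rewrite /frame /= eval_single_fresh //; apply: trans.
apply: trans (eval_mul _ _ _) _; apply: le_mul2r => //.
by rewrite eval_tsingle dia_off_fixed; [apply: le_refl|apply: fixed_dia].
Qed.

Lemma embed_hom : @is_hom M (full_functional completion nat) embed.
Proof.
split; [exact: embed_bin|exact: embed_con|exact: embed_box|exact: embed_dia].
Qed.

Lemma embed_inj : injective embed.
Proof.
have le_embed a b : embed a = embed b -> le a b.
  move=> ab; have := below_single 0 a.
  rewrite -[below 0 a]/(proj1_sig (embed a 0)) ab /= /below eval_tsingle.
  by rewrite /dia_off eqxx.
by move=> a b ab; apply: le_anti => //; apply: le_embed.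
Qed.

End Representation.

(** * Composition and images of homomorphisms *)

Lemma is_hom_comp (M N K : modal_algebra) (g : N -> K) (f : M -> N) :
  is_hom g -> is_hom f -> is_hom (g \o f).
Proof.
move=> [gb gc gbox gdia] [fb fc fbox fdia].
split=> [s x y|c|x|x] /=.
- by rewrite fb gb.
- by rewrite fc gc.
- by rewrite fbox gbox.
by rewrite fdia gdia.
Qed.

Section Image.
Variables (M N : modal_algebra) (f : M -> N) (homf : is_hom f).

Definition image (y : N) := exists x, f x = y.

Lemma image_bin s x y : image x -> image y -> image (bin s x y).
Proof. by case: homf => fb _ _ _ [a <-] [b <-]; exists (bin s a b). Qed.

Lemma image_con c : image (con N c).
Proof. by case: homf => _ fc _ _; exists (con M c). Qed.

Lemma image_box x : image x -> image (box x).
Proof. by case: homf => _ _ fb _ [a <-]; exists (box a). Qed.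

Lemma image_dia x : image x -> image (dia x).
Proof. by case: homf => _ _ _ fd [a <-]; exists (dia a). Qed.

Definition image_subuniverse : subuniverse N :=
  Subuniverse image_bin image_con image_box image_dia.

Lemma isomorphic_image : injective f -> isomorphic M (subalgebra image_subuniverse).
Proof.
move=> injf.
have sub_eq (a b : subalgebra image_subuniverse) : proj1_sig a = proj1_sig b -> a = b.
  case: a b => [a pa] [b pb] /= ab; move: pb; rewrite -ab => pb.
  by rewrite (proof_irrelevance _ pa pb).
have im x : image (f x) by exists x.
exists (fun x => exist _ (f x) (im x)); split.
  case: homf => fb fc fbox fdia.
  by split=> [s x y|c|x|x]; apply: sub_eq => /=.
(* [bijective] asks for an inverse function, so preimages are chosen by description. *)
have inv y : image y -> {x | f x = y} by apply: constructive_indefinite_description.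
exists (fun y : subalgebra image_subuniverse => proj1_sig (inv _ (proj2_sig y))).
  by move=> x; case: (inv _) => y /= /injf.
by move=> y; apply: sub_eq => /=; case: (inv _).
Qed.

End Image.

(** * The three varieties treated uniformly *)

Section Variety.
Variables (V : Ls_algebra -> Prop) (hV : V = FLe \/ V = FLew \/ V = FLec).

Lemma V_FLe A : V A -> FLe A.
Proof. by case: hV => [->|[->|->]] // []. Qed.

Lemma V_power A W : V A -> V (power A W).
Proof.
case: hV => [->|[->|->]]; first exact: FLe_power.
  exact: FLew_power.
exact: FLec_power.
Qed.

Lemma functional_embedding (M : modal_algebra) : mV V M ->
  exists (A : Ls_algebra) (f : M -> full_functional A nat),
    [/\ complete_members V A, is_hom f & injective f].
Proof.
case=> mM VM; have fleM := V_FLe VM.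
exists (completion fleM), (embed fleM); split.
- split; last exact: completion_complete.
  move: VM; case: hV => [->|[->|->]] VM.
  + exact: completion_FLe.
  + exact: completion_FLew.
  exact: completion_FLec.
- exact: embed_hom.
exact: embed_inj.
Qed.

Lemma mV_full_functional A W : complete_members V A -> inhabited W ->
  mV V (full_functional A W).
Proof.
case=> VA cA W0; split; last exact: V_power.
by case: (V_FLe VA) => lat _ _; apply: m_lattice_full_functional.
Qed.

End Variety.

(** * First-order values as modal homomorphisms *)

Section Values.
Variables (A : Ls_algebra) (S : structure A).

Fixpoint modal_value (alpha : modal_formula) :
    full_functional A (domain S) :=
  match alpha with
  | Var i => interp (s := S) i
  | MBin s a b => bin s (modal_value a) (modal_value b)
  | MCon c => con (full_functional A (domain S)) c
  | Box a => box (modal_value a)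
  | Dia a => dia (modal_value a)
  end.

Lemma modal_value_hom :
  @is_hom modal_formula_algebra (full_functional A (domain S)) (modal_value).
Proof. by []. Qed.

(** Stated for any homomorphism with the right values on variables, so that it serves both
    [modal_value] and a modal valuation followed by an embedding. *)
Lemma hom_star (h : modal_formula_algebra -> full_functional A (domain S)) :
  is_hom h -> (forall i, h (Var i) = interp (s := S) i) ->
  forall phi, h (star phi) = value (S := S) phi.
Proof.
case=> hb hc hbox hdia hv; elim=> [i|s a IHa b IHb|c|a IH|a IH] /=.
- exact: hv.
- by rewrite (hb s (star a) (star b)) IHa IHb.
- exact: (hc c).
- by rewrite (hbox (star a)) IH.
by rewrite (hdia (star a)) IH.
Qed.

End Values.

Theorem theorem5p2 (V : Ls_algebra -> Prop)
  (hV : V = FLe \/ V = FLew \/ V = FLec) :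
  (forall M : modal_algebra, mV V M -> functional V M) /\
  (forall (T : equation fo_formula -> Prop) (phi psi : fo_formula),
     fo_consequence (complete_members V) T (phi, psi) <->
     modal_consequence (mV V) (star_set T) (star phi, star psi)).
Proof.
split=> [M /(functional_embedding hV) [A [f [VA homf injf]]]|T phi psi].
  by exists A, nat, (image_subuniverse homf); split=> //; apply: isomorphic_image.
split=> [foT M /(functional_embedding hV) [A [f [VA homf injf]]] h homh hT
        |mT A VA S ST u].
  (* The embedded valuation is a family of functions on [nat], that is, a structure with domain
     [nat]. Injectivity of [f] carries the resulting equation back to [M]. *)
  pose S := Structure (inhabits 0) (fun i => f (h (Var i))).
  have E : forall chi, f (h (star chi)) = value (S := S) chi.
    exact: (hom_star (S := S) (is_hom_comp homf homh)).
  apply: injf; rewrite /= !E; apply: functional_extensionality.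
  apply: (foT A VA S) => -[a b] Tab u /=.
  by rewrite -!E (hT (star a, star b)) //; exists (a, b).
(* Conversely, a structure is a valuation in the full functional algebra over its domain, a member
   of [mV V]. *)
have E := hom_star (modal_value_hom S) (fun=> erefl).
rewrite /= -!E.
have := mT _ (mV_full_functional hV VA (domain_nonempty S)) _ (modal_value_hom S).
move=> /= -> // _ [[a b] [Tab <-]] /=; rewrite !E.
apply: functional_extensionality; exact: ST Tab.
Qed.
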